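(* Let $p$ be a prime and let $G$ be a finite group with center $Z(G)$ such that $G/Z(G) \cong \mathbb{Z}_p \times \mathbb{Z}_p$. Then the spectrum of the commuting graph $\Gamma_G$ of $G$ is $$\operatorname{Spec}(\Gamma_G) = \{(-1)^{(p^2 - 1)|Z(G)| - p - 1},\ ((p - 1)|Z(G)| - 1)^{p + 1}\}.$$
   Context: For a non-abelian group $G$ with center $Z(G)$, the commuting graph $\Gamma_G$ is the simple undirected graph with vertex set $G\setminus Z(G)$ in which two distinct vertices $x,y$ are adjacent if and only if $xy=yx$. The spectrum $\operatorname{Spec}(\mathcal{G})=\{\lambda_1^{k_1},\dots,\lambda_n^{k_n}\}$ of a finite graph $\mathcal{G}$ is the multiset of eigenvalues of its adjacency matrix, where $\lambda^{k}$ means that the eigenvalue $\lambda$ is listed with multiplicity $k$ (if the same value is listed more than once, the multiplicities add). *)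

(* Defs.v *)
From HB Require Import structures.
From mathcomp Require Import all_boot all_order all_fingroup all_algebra all_solvable.
From mathcomp Require Import finmap multiset.

Set Implicit Arguments.
Unset Strict Implicit.
Unset Printing Implicit Defensive.

Import GRing.Theory.
Local Open Scope mset_scope.
Local Open Scope ring_scope.

(* A simple graph on a finite type T is given by its adjacency relation; its
   vertices are numbered by enum_val to index the adjacency matrix. *)
Definition adjacency_mx (R : nzRingType) (T : finType) (e : rel T) :
    'M[R]_#|T| :=
  \matrix_(i, j) (e (enum_val i) (enum_val j))%:R.

(* The eigenvalues are listed with their algebraic multiplicities, that is, as
   the roots of the characteristic polynomial. *)
Definition mx_spectrum (C : closedFieldType) (n : nat) (A : 'M[C]_n) :
    {mset C} :=
  seq_mset (sval (closed_field_poly_normal (char_poly A))).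

Lemma char_poly_spectrum (C : closedFieldType) (n : nat) (A : 'M[C]_n) :
  char_poly A = \prod_(z <- mx_spectrum A) ('X - z%:P).
Proof.
rewrite (perm_big _ (perm_eq_seq_mset _)) /=.
case: closed_field_poly_normal => s /= ->.
by rewrite (monicP (char_poly_monic A)) scale1r.
Qed.

Definition graph_spectrum (C : numClosedFieldType) (T : finType) (e : rel T) :
    {mset C} :=
  mx_spectrum (adjacency_mx C e).

Definition noncentral (gT : finGroupType) (G : {group gT}) : finType :=
  {x : gT | x \in G :\: 'Z(G)%g}.

Definition commuting_graph (gT : finGroupType) (G : {group gT}) :
    rel (noncentral G) :=
  fun x y => (x != y) && (val x * val y == val y * val x)%g.

(* Main.v *)
Require Import Defs.
From mathcomp Require Import all_boot all_order all_fingroup all_algebra all_solvable.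
From mathcomp Require Import finmap multiset.
From mathcomp Require Import ring zify.
Local Open Scope ring_scope.

(** Since [Z(G)] has index [p ^ 2], the centralizer of a noncentral [x] lies
    strictly between [Z(G)] and [G], so it has index [p] over [Z(G)]
    ([index_center_cent1]); being a cyclic extension of a central subgroup, it
    is abelian ([abelian_cent1]). Hence commuting is transitive, thus an
    equivalence relation, on the noncentral elements
    ([equivalence_commuting]), and the class of [x], its centralizer minus the
    center, has [m = (p - 1) * #|Z(G)|] elements ([card_commuting]). The
    commuting graph is therefore a disjoint union of cliques of size [m], and
    as there are [(p ^ 2 - 1) * #|Z(G)| = (p + 1) * m] vertices, the number of
    cliques is [p + 1].

    The spectrum of a disjoint union of [k] cliques of size [m]
    ([graph_spectrum_cliques]) can be found without exhibiting eigenvectors.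
    If [A] is the adjacency matrix then [J = A + 1] is the matrix of the
    equivalence relation, and counting the common neighbours of two vertices
    gives [J ^ 2 = m J]. So every eigenvalue of [A] is [-1] or [m - 1], and the
    two multiplicities, which add up to [k * m], are determined by the
    vanishing of the trace of [A] ([mx_spectrum_quadratic]). *)

Set Implicit Arguments.
Unset Strict Implicit.
Unset Printing Implicit Defensive.

Import GRing.Theory Num.Theory.

Lemma mem_mx_spectrum (C : closedFieldType) (n : nat) (A : 'M[C]_n) (z : C) :
  (z \in (mx_spectrum A : seq C)) = eigenvalue A z.
Proof.
by rewrite eigenvalue_root_char char_poly_spectrum root_prod_XsubC.
Qed.

Lemma size_mx_spectrum (C : closedFieldType) (n : nat) (A : 'M[C]_n) :
  size (mx_spectrum A : seq C) = n.
Proof.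
apply: succn_inj.
by rewrite -(size_prod_XsubC _ id) -char_poly_spectrum size_char_poly.
Qed.

Lemma sum_mx_spectrum (C : closedFieldType) (n : nat) (A : 'M[C]_n) :
  \sum_(z <- (mx_spectrum A : seq C)) z = \tr A.
Proof.
case: n A => [|n] A.
  by rewrite (size0nil (size_mx_spectrum A)) big_nil /mxtrace big_ord0.
apply: oppr_inj; rewrite -(char_poly_trace A) // char_poly_spectrum.
by rewrite -[X in _`_X.-1](size_mx_spectrum A) coefPn_prod_XsubC // size_mx_spectrum.
Qed.

(** An eigenvalue of [A] is a root of any polynomial that annihilates [A], so
    [a] and [b] are the only ones; the size of the matrix and its trace are two
    linear equations for the two multiplicities, with determinant [b - a]. The
    multiplicities are natural numbers, and characteristic 0 makes it possible
    to solve for them in [C]. *)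
Lemma mx_spectrum_quadratic (C : numClosedFieldType) (n i j : nat) (a b : C)
    (A : 'M[C]_n) :
    a != b -> (A - a%:M) *m (A - b%:M) = 0 ->
    (i + j)%N = n -> a *+ i + b *+ j = \tr A ->
  mx_spectrum A = (msetn i a `+` msetn j b)%mset.
Proof.
move=> neq_ab A_ab def_n trA; set s : seq C := mx_spectrum A.
have s_ab z : z \in s -> (z == a) || (z == b).
  rewrite mem_mx_spectrum => /eigenvalueP[v vA nz_v].
  have vAsub c : v *m (A - c%:M) = (z - c) *: v.
    by rewrite mulmxBr vA mul_mx_scalar scalerBl.
  have: (z - a) *: ((z - b) *: v) == 0.
    by rewrite -vAsub scalemxAl -vAsub -mulmxA A_ab mulmx0.
  by rewrite !scaler_eq0 (negPf nz_v) orbF !subr_eq0.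
have count_s : (count_mem a s + count_mem b s)%N = n.
  rewrite -[n in RHS](size_mx_spectrum A) -/s -(count_predT s) -count_predUI.
  rewrite [X in (_ + X)%N](eq_count (a2 := pred0)) ?count_pred0 ?addn0 => [|z /=].
    by apply: eq_in_count => z /s_ab /=.
  by apply: contraNF neq_ab => /andP[/eqP <- /eqP <-].
have sum_s : a *+ count_mem a s + b *+ count_mem b s = \tr A.
  rewrite -sum_mx_spectrum -/s; elim: s s_ab {count_s} => [|z s IHs] s_ab.
    by rewrite big_nil !mulr0n addr0.
  rewrite big_cons -IHs => [|y y_s]; last by rewrite s_ab // inE y_s orbT.
  case/orP: (s_ab z (mem_head z s)) => /eqP-> /=; rewrite eqxx.
    by rewrite (negPf neq_ab) !mulrnDr mulr1n mulr0n add0r addrA.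
  by rewrite eq_sym (negPf neq_ab) !mulrnDr mulr1n mulr0n add0r addrCA.
have count_a : count_mem a s = i.
  apply/eqP; rewrite -(eqr_nat C); apply/eqP.
  have eqD : (count_mem a s)%:R + (count_mem b s)%:R = i%:R + j%:R :> C.
    by rewrite -!natrD count_s def_n.
  have eqS : a * (count_mem a s)%:R + b * (count_mem b s)%:R
             = a * i%:R + b * j%:R by rewrite !mulr_natr sum_s trA.
  have nz_ab : a - b != 0 by rewrite subr_eq0.
  (* Cramer's rule: eliminate the multiplicity of [b] from [eqS] using [eqD]. *)
  apply/(mulfI nz_ab)/subr0_eq; rewrite -mulrBr.
  have -> : (a - b) * ((count_mem a s)%:R - i%:R) =
      (a * (count_mem a s)%:R + b * (count_mem b s)%:R - (a * i%:R + b * j%:R))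
      - b * ((count_mem a s)%:R + (count_mem b s)%:R - (i%:R + j%:R)) by ring.
  by rewrite eqS eqD !subrr mulr0 subrr.
have count_b : count_mem b s = j by lia.
apply/msetP => z; rewrite msetE2 !msetnE -count_mem_mset -/s.
have [->|neq_za] := eqVneq z a; first by rewrite (negPf neq_ab) addn0.
have [->|neq_zb] := eqVneq z b; first by [].
by apply/count_memPn/negP => /s_ab; rewrite (negPf neq_za) (negPf neq_zb).
Qed.

(** The graph is the disjoint union of [k] cliques of size [m]. The identity
    [J *m J = m%:R *: J] below holds because the [(i, j)] entry of the square
    counts the vertices equivalent to both [i] and [j]: the whole class if
    [i] and [j] are equivalent, and none otherwise. *)
Lemma graph_spectrum_cliques (C : numClosedFieldType) (T : finType) (R : rel T)
    (k m : nat) :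
    equivalence_rel R -> (0 < m)%N -> (forall x, #|R x| = m) ->
    #|T| = (k * m)%N ->
  graph_spectrum C (fun x y => (x != y) && R x y) =
    (msetn (k * m - k)%N (-1) `+` msetn k (m%:R - 1))%mset.
Proof.
move=> eqR m_gt0 cardR cardT; rewrite /graph_spectrum.
set A := adjacency_mx C _.
have /equivalence_relP[Rxx Rsub] := eqR.
pose J : 'M[C]_#|T| := \matrix_(i, j) (R (enum_val i) (enum_val j))%:R.
have defA : A = J - 1%:M.
  apply/matrixP => i j; rewrite !mxE /= (inj_eq enum_val_inj).
  by case: eqVneq => [->|_]; rewrite ?Rxx ?subrr ?subr0.
have JJ : J *m J = m%:R *: J.
  apply/matrixP => i j; rewrite !mxE.
  under eq_bigr => l _ do rewrite !mxE -natrM mulnb.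
  rewrite -natr_sum -natrM; congr (_%:R).
  rewrite -(big_enum_val
    (fun x => nat_of_bool (R (enum_val i) x && R x (enum_val j)))) /=.
  have [Rij|nRij] := boolP (R (enum_val i) (enum_val j)).
    rewrite muln1 -(cardR (enum_val i)) -sum1_card big_mkcond [RHS]big_mkcond /=.
    apply: eq_bigr => x _; rewrite unfold_in.
    by case Rix: (R _ x) => //=; rewrite -(Rsub _ _ Rix) Rij.
  rewrite muln0 big1 // => x _; case Rix: (R _ x) => //=.
  by rewrite -(Rsub _ _ Rix) (negPf nRij).
apply: mx_spectrum_quadratic.
- by rewrite eq_sym -subr_eq0 opprK subrK pnatr_eq0 -lt0n.
- have -> : A - (-1)%:M = J by rewrite defA raddfN opprK subrK.
  have -> : A - (m%:R - 1)%:M = J - m%:R%:M.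
    by rewrite defA raddfB opprB addrA subrK.
  by rewrite mulmxBr JJ mul_mx_scalar subrr.
- by rewrite subnK ?cardT // leq_pmulr.
have -> : \tr A = 0.
  by rewrite /mxtrace big1 // => i _; rewrite !mxE /= eqxx.
by rewrite -(mulr_natr (-1)) -(mulr_natr (_ - 1)) natrB ?leq_pmulr // natrM; ring.
Qed.

Lemma card_factor_isog_Zp2 (p : nat) (gT : finGroupType) (G : {group gT}) :
    prime p -> (G / 'Z(G) \isog [set: 'Z_p * 'Z_p])%g ->
  #|G : 'Z(G)|%g = (p ^ 2)%N.
Proof.
move=> p_prime isoG.
rewrite -card_quotient ?gFnorm // (card_isog isoG) cardsT card_prod card_ord.
by rewrite Zp_cast ?prime_gt1.
Qed.

Section CenterOfIndexPrimeSquared.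

Variables (p : nat) (gT : finGroupType) (G : {group gT}).
Hypotheses (p_prime : prime p) (indexZ : #|G : 'Z(G)|%g = (p ^ 2)%N).

Lemma center_sub_cent1 (x : gT) : x \in G -> 'Z(G)%g \subset 'C_G[x]%g.
Proof. by move=> Gx; rewrite -cent_set1 setIS ?centS ?sub1set. Qed.

(** The index divides [p ^ 2]; it is not 1 because [x] is in its centralizer but
    not in the center, and not [p ^ 2] because [x] does not centralize [G]. *)
Lemma index_center_cent1 (x : gT) :
  x \in G -> x \notin 'Z(G)%g -> #|'C_G[x] : 'Z(G)|%g = p.
Proof.
move=> Gx nZx.
have sZC := center_sub_cent1 Gx.
have := Lagrange_index (subcent1_sub x G) sZC; rewrite indexZ => def_p2.
have: (#|'C_G[x] : 'Z(G)|%g %| p ^ 2)%N by rewrite -def_p2 dvdn_mull.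
case/(dvdn_pfactor _ _ p_prime) => -[|[|[|//]]] _ def_p; rewrite def_p //.
  move/eqP: def_p; rewrite indexg_eq1 => /subsetP/(_ x (subcent1_id Gx)).
  by rewrite (negPf nZx).
move: def_p2; rewrite def_p -[X in _ = X]mul1n => /eqP.
rewrite eqn_pmul2r ?expn_gt0 ?prime_gt0 // indexg_eq1 => sGC.
by case/negP: nZx; rewrite inE Gx -sub_cent1 (subset_trans sGC) ?subsetIr.
Qed.

Lemma abelian_cent1 (x : gT) :
  x \in G -> x \notin 'Z(G)%g -> abelian 'C_G[x]%g.
Proof.
move=> Gx nZx.
have sZC := center_sub_cent1 Gx.
have nsZC : ('Z(G) <| 'C_G[x])%g.
  exact: normalS sZC (subcent1_sub x G) (center_normal G).
apply: (@cyclic_factor_abelian _ 'Z(G)%G).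
  rewrite subsetI sZC (subset_trans (subsetIr _ _)) ?centS ?subcent1_sub //.
apply: prime_cyclic; rewrite card_quotient ?normal_norm //.
by rewrite index_center_cent1.
Qed.

Lemma card_noncentral : #|noncentral G| = ((p ^ 2 - 1) * #|'Z(G)%g|)%N.
Proof.
rewrite card_sig cardsD (setIidPr (center_sub G)) mulnBl mul1n.
by rewrite mulnC -indexZ Lagrange ?center_sub.
Qed.

Definition commuting (x y : noncentral G) := (val x * val y == val y * val x)%g.

(** Two elements that commute with a noncentral [x] lie in the centralizer of
    [x], which is abelian. *)
Lemma equivalence_commuting : equivalence_rel commuting.
Proof.
have subC (x y z : noncentral G) :
    commuting x y -> commuting x z -> commuting y z.
  move=> /eqP xy /eqP xz.
  have /setDP[Gx nZx] := valP x; have /setDP[Gy _] := valP y.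
  have /setDP[Gz _] := valP z.
  apply/eqP; apply: (centsP (abelian_cent1 Gx nZx)); exact/subcent1P.
apply/equivalence_relP; split=> [x | x y Rxy z]; first exact: eqxx.
apply/idP/idP => [|Ryz]; first exact: subC.
by apply: (subC y) => //; rewrite /commuting eq_sym.
Qed.

Lemma card_commuting (x : noncentral G) :
  #|commuting x| = ((p - 1) * #|'Z(G)%g|)%N.
Proof.
have /setDP[Gx nZx] := valP x.
have sZC := center_sub_cent1 Gx.
rewrite -(card_imset _ val_inj).
transitivity #|'C_G[val x] :\: 'Z(G)|%g.
  apply: eq_card => y; apply/imsetP/setDP => [[z Rxz ->]|[/subcent1P[Gy xy] nZy]].
    have /setDP[Gz nZz] := valP z.
    by split=> //; apply/subcent1P; split=> //; apply/eqP.
  have Py : y \in G :\: 'Z(G)%g by apply/setDP.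
  by exists (exist _ y Py) => //; apply/eqP.
rewrite cardsD (setIidPr sZC) mulnBl mul1n mulnC.
by rewrite -(index_center_cent1 Gx nZx) Lagrange.
Qed.

End CenterOfIndexPrimeSquared.

Theorem theorem2p1 (C : numClosedFieldType) (p : nat) (gT : finGroupType)
    (G : {group gT}) (p_prime : prime p)
    (isoG : (G / 'Z(G) \isog [set: 'Z_p * 'Z_p])%g) :
  graph_spectrum C (@commuting_graph gT G) =
    (msetn ((p ^ 2 - 1) * #|'Z(G)%g| - p - 1)%N (-1 : C) `+`
     msetn (p + 1)%N ((p%:R - 1) * #|'Z(G)%g|%:R - 1 : C))%mset.
Proof.
have indexZ := card_factor_isog_Zp2 p_prime isoG.
have p_gt1 := prime_gt1 p_prime.
have card_m : ((p ^ 2 - 1) * #|'Z(G)%g| = (p + 1) * ((p - 1) * #|'Z(G)%g|))%N.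
  by rewrite -[1%N in LHS](exp1n 2) subn_sqr -mulnA mulnCA.
rewrite card_m -subnDA -[p%:R - 1](natrB _ (ltnW p_gt1)) -natrM.
apply: (graph_spectrum_cliques C (equivalence_commuting p_prime indexZ)).
- by rewrite muln_gt0 subn_gt0 p_gt1 cardG_gt0.
- exact: card_commuting.
- by rewrite (card_noncentral indexZ).
Qed.
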